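(* If $z\in\mathbb{C}$ is a Galois conjugate of an Yrrap number, then $|z|\le \dfrac{1+\sqrt5}{2}$.
   Context: Throughout, $\beta>1$ is a non-integer real number, and $\{y\}$ denotes the fractional part of $y\in\mathbb{R}$. $\beta$ is called an Yrrap number if the orbit of $1$ under the negative $\beta$-transformation $[0,1]\to[0,1]$, $x\mapsto 1-\{\beta x\}$, is a finite set. Yrrap numbers are algebraic integers. A Galois conjugate of $\beta$ means a root in $\mathbb{C}$, different from $\beta$ itself, of the minimal polynomial of $\beta$ over $\mathbb{Q}$. *)

(* Defs.v *)
From HB Require Import structures.
From mathcomp Require Import all_boot all_order all_algebra.
From mathcomp Require Import boolp classical_sets cardinality reals.
From mathcomp Require Import complex.

Set Implicit Arguments.
Unset Strict Implicit.
Unset Printing Implicit Defensive.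

Import Order.TTheory GRing.Theory Num.Theory.

Local Open Scope ring_scope.

Definition frac_part (R : realType) (y : R) : R := y - (Num.floor y)%:~R.

(* Given on all of R, this maps R into ]0, 1], so it restricts to a self-map
   of [0, 1], and the orbit of 1 below stays in [0, 1]. *)
Definition neg_beta_map (R : realType) (beta x : R) : R :=
  1 - frac_part (beta * x).

(* The standing assumption that beta > 1 is not an integer is not part of this
   predicate: it has to be assumed separately. *)
Definition yrrap (R : realType) (beta : R) : Prop :=
  finite_set (range (fun n : nat => iter n (neg_beta_map beta) 1)).

Definition is_minimal_polynomial (F : numFieldType) (a : F) (p : {poly rat}) :
  Prop :=
  [/\ p \is monic, root (map_poly ratr p) a
    & forall q : {poly rat},
        q != 0 -> root (map_poly ratr q) a -> (size p <= size q)%N].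

Definition galois_conjugate (R : realType) (beta : R) (z : R[i]) : Prop :=
  z <> (beta%:C)%C /\
  exists2 p : {poly rat},
    is_minimal_polynomial beta p & root (map_poly ratr p) z.

(* Main.v *)
(** If [x_n] is the orbit of [1], then [x_(n+1) = d_n - beta x_n] with [d_n] an
    integer, so [x_n = P_n(beta)] for polynomials [P_n] with rational (indeed
    integer) coefficients.  Since the orbit is finite, so is the set of the
    [P_n(z)], and as [P_n(z) - x_n = (beta - z) * \sum_(k < n) x_k (-z)^(n-1-k)],
    the point [w = -1/z], when [|w| < 1], is a zero of the power series
    [g = \sum_k x_k w^k], with [x_0 = 1] and the other [x_k] in [[0, 1]].
    Subtracting the series with coefficients [1, 1/2, 1/2, ...], whose sum is
    [(2 - w) / (2 (1 - w))], leaves coefficients of modulus at most [1/2], whence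
    [|2 - w| / |1 - w| <= |w| / (1 - |w|)].  This forces [|w|^2 + |w| >= 1]. *)
Require Import Defs.
From HB Require Import structures.
From mathcomp Require Import all_boot all_order all_algebra.
From mathcomp Require Import ring lra.
From mathcomp Require Import boolp classical_sets cardinality reals.
From mathcomp Require Import topology normedtype sequences.
From mathcomp Require Import complex.

Set Implicit Arguments.
Unset Strict Implicit.
Unset Printing Implicit Defensive.

Import Order.TTheory GRing.Theory Num.Theory.

Local Open Scope ring_scope.

(** * Transfer of equalities from [beta] to its conjugates *)

Lemma finite_range_bounded (T : choiceType) (R : realDomainType)
    (f : nat -> T) (g : nat -> R) :
  finite_set (range f) -> (forall m n, f m = f n -> g m = g n) ->
  exists M, forall n, g n <= M.
Proof.
move=> /finite_seqP[s fs] fg.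
suff [M MP] : exists M, forall n, f n \in s -> g n <= M.
  exists M => n; apply: MP; have : range f (f n) by exists n.
  by rewrite fs.
elim: s {fs} => [|a s [M IH]]; first by exists 0.
have [[m fm]|nofm] := pselect (exists m, f m = a).
  exists (Num.max M (g m)) => n; rewrite inE le_max => /orP[/eqP fn|/IH->//].
  by rewrite (fg n m) ?lexx ?orbT // fn.
exists M => n; rewrite inE => /orP[/eqP fn|/IH//].
by case: nofm; exists n.
Qed.

Lemma minimal_polynomial_dvdp (F : numFieldType) (a : F) (p q : {poly rat}) :
  is_minimal_polynomial a p -> root (map_poly ratr q) a -> (p %| q)%R.
Proof.
move=> [p_monic pa pmin] qa; apply/modp_eq0P/eqP; apply: contraT => r_neq0.
have : (size p <= size (q %% p)%R)%N.
  apply: pmin => //.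
  move: qa; rewrite {1}(divp_eq q p) rmorphD rmorphM /= !rootE hornerD hornerM.
  by rewrite (rootP pa) mulr0 add0r.
by rewrite leqNgt ltn_modp monic_neq0.
Qed.

(** The minimal polynomial divides [p - q]. This makes the values of the orbit polynomials at [z]
    depend only on the orbit points, hence finite in number. *)
Lemma conjugate_horner (R : realType) (beta : R) (z : R[i]) (p q : {poly rat}) :
  galois_conjugate beta z ->
  (map_poly ratr p).[beta] = (map_poly ratr q).[beta] ->
  (map_poly ratr p).[z] = (map_poly ratr q).[z].
Proof.
move=> [_ [m m_min mz]] pq.
have /(minimal_polynomial_dvdp m_min)/(dvdpP _ _)[c mdvd] :
    root (map_poly ratr (p - q)) beta.
  by rewrite rmorphB rootE hornerD hornerN pq subrr.
apply/eqP; rewrite -subr_eq0 -hornerN -hornerD -rmorphB mdvd rmorphM /=.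
by rewrite hornerM (rootP mz) mulr0.
Qed.

(** * The orbit of 1 as polynomials in [beta] *)

Section Orbit.
Variables (R : realType) (beta : R).

Let x n := iter n (neg_beta_map beta) 1.

Lemma neg_beta_orbit_itv n : 0 <= x n <= 1.
Proof.
case: n => [|n]; first by rewrite ler01 lexx.
rewrite /x /= /neg_beta_map /frac_part; set y := beta * _.
by have := floor_itv y; rewrite rmorphD /=; lra.
Qed.

(** The [+ 1] comes from [1 - frac_part y = floor y + 1 - y]. *)
Let digit n : int := Num.floor (beta * x n) + 1.

Fixpoint orbit_poly n : {poly rat} :=
  if n is m.+1 then (digit m)%:~R%:P - 'X * orbit_poly m else 1.

Lemma orbit_polyS_horner (F : numFieldType) (a : F) n :
  (map_poly ratr (orbit_poly n.+1)).[a] =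
  (digit n)%:~R - a * (map_poly ratr (orbit_poly n)).[a].
Proof.
rewrite /= rmorphB rmorphM /= map_polyC map_polyX !hornerE /=.
by rewrite rmorph_int.
Qed.

Lemma orbit_poly_horner n : (map_poly ratr (orbit_poly n)).[beta] = x n.
Proof.
elim: n => [|n IH]; first by rewrite /= rmorph1 hornerC.
rewrite orbit_polyS_horner IH /digit rmorphD /= /neg_beta_map /frac_part.
by rewrite -/(x n); ring.
Qed.

(** Values at [z] and at [beta] obey the same recurrence with the same digits, so their difference
    satisfies [e_(n+1) = - z e_n + (beta - z) x_n]. Scaling by [(- z^-1) ^+ n] makes this
    telescope. *)
Lemma orbit_poly_conjugate (z : R[i]) n : z != 0 ->
  ((map_poly ratr (orbit_poly n)).[z] - (x n)%:C%C) * (- z^-1) ^+ n =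
  (beta%:C%C - z) * - z^-1 * \sum_(k < n) (x k)%:C%C * (- z^-1) ^+ k.
Proof.
move=> z0; elim: n => [|n IH].
  by rewrite big_ord0 mulr0 /= rmorph1 hornerC subrr mul0r.
rewrite big_ord_recr /= mulrDr -IH orbit_polyS_horner.
have -> : (x n.+1)%:C%C = (digit n)%:~R - beta%:C%C * (x n)%:C%C :> R[i].
  have := orbit_polyS_horner beta n; rewrite !orbit_poly_horner => ->.
  by rewrite rmorphB rmorphM /= rmorph_int.
by rewrite exprS; field.
Qed.

Lemma yrrap_conjugate_bounded (z : R[i]) :
  yrrap beta -> galois_conjugate beta z ->
  exists M : R, forall n,
    `|(map_poly ratr (orbit_poly n)).[z] - (x n)%:C%C| <= M%:C%C.
Proof.
move=> fin zconj.
pose h n := `|(map_poly ratr (orbit_poly n)).[z] - (x n)%:C%C|.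
have [|M MP] := @finite_range_bounded _ _ _ (fun n => complex.Re (h n)) fin.
  move=> m n mn; rewrite /h /x mn.
  by rewrite (@conjugate_horner _ _ _ (orbit_poly m) (orbit_poly n) zconj) //
     !orbit_poly_horner.
exists M => n; move: (MP n); rewrite -lecR; apply: le_trans.
by rewrite -/(h n) /h normc_def.
Qed.

End Orbit.

(** * Zeros of power series with coefficients in [0, 1] *)

Section ZeroFree.
Import numFieldNormedType.Exports.

(** Truncated comparison with the coefficients 1, 1/2, 1/2, ...: times [2 * (1 - w)], their partial
    sum up to degree [n] is [2 - w - w ^+ n.+1]. *)
Lemma sub2_partial_sum (F : comPzRingType) (x : nat -> F) (w : F) n :
  x 0%N = 1 ->
  2 - w = w ^+ n.+1 + 2 * (1 - w) * (\sum_(k < n.+1) x k * w ^+ k) +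
    (1 - w) * \sum_(k < n) (1 - 2 * x k.+1) * w ^+ k.+1.
Proof.
move=> x0; elim: n => [|n IH].
  by rewrite big_ord1 big_ord0 x0; ring.
by rewrite {}IH !big_ord_recr /= !exprS; ring.
Qed.

Lemma norm_sub2_partial_sum (F : numFieldType) (x : nat -> F) (w : F) n :
  x 0%N = 1 -> (forall k, 0 <= x k <= 1) -> `|w| <= 1 ->
  `|2 - w| * (1 - `|w|) <= `|1 - w| * `|w| + `|w| ^+ n.+1 +
     2 * `|1 - w| * `|\sum_(k < n.+1) x k * w ^+ k|.
Proof.
move=> x0 x01 w1; have w1' : 0 <= 1 - `|w| by rewrite subr_ge0.
rewrite {1}(sub2_partial_sum w n x0).
set G := \sum_(k < _) x k * _; set H := \sum_(k < n) _.
have HE : `|H| * (1 - `|w|) <= `|w|.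
  apply: (@le_trans _ _ ((\sum_(k < n) `|w| ^+ k.+1) * (1 - `|w|))).
    rewrite ler_wpM2r //; apply: le_trans (ler_norm_sum _ _ _) _.
    apply: ler_sum => k _; rewrite normrM normrX ler_piMl ?exprn_ge0 //.
    have /andP[xk0 xk1] := x01 k.+1.
    (* The order on [F] is partial, so [1 - 2 * x k.+1] must be real before its norm can be bounded
       by two inequalities. *)
    rewrite real_ler_norml ?realB ?realM ?realn ?(ger0_real xk0) //.
    by rewrite lerBrDr addrC !lerBlDr lerDl mulr_ge0 // ler_piMr.
  have -> : (\sum_(k < n) `|w| ^+ k.+1) * (1 - `|w|) = `|w| - `|w| ^+ n.+1.
    elim: n {G H} => [|n IH]; first by rewrite big_ord0; ring.
    by rewrite big_ord_recr /= mulrDl IH (exprS _ n.+1); ring.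
  by rewrite lerBlDr lerDl exprn_ge0.
have T0 : 0 <= `|w| ^+ n.+1 + 2 * `|1 - w| * `|G|.
  by rewrite addr_ge0 ?mulr_ge0 ?exprn_ge0.
apply: (@le_trans _ _
  ((`|w| ^+ n.+1 + 2 * `|1 - w| * `|G| + `|1 - w| * `|H|) * (1 - `|w|))).
  rewrite ler_wpM2r //; apply: le_trans (ler_normD _ _) _.
  rewrite !normrM lerD2r; apply: le_trans (ler_normD _ _) _.
  by rewrite normrX !normrM (ger0_norm (ler0n _ 2)).
rewrite mulrDl addrC -[leRHS]addrA; apply: lerD; first by rewrite -mulrA ler_wpM2l.
by rewrite ler_piMr // lerBlDr lerDl.
Qed.

Lemma golden_bound_of_norm_sub_le (R : rcfType) (w : R[i]) (r : R) :
  `|w| = (r%:C)%C -> r < 1 -> `|2 - w| * (1 - `|w|) <= `|1 - w| * `|w| ->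
  1 <= r + r ^+ 2.
Proof.
case: w => a b; rewrite !normc_def /= => -[rE] r1.
rewrite rE.
have r0 : 0 <= r by rewrite -rE sqrtr_ge0.
have ab0 (c : R) : 0 <= c ^+ 2 + b ^+ 2 by rewrite addr_ge0 ?sqr_ge0.
have r2 : r ^+ 2 = a ^+ 2 + b ^+ 2 by rewrite -rE sqr_sqrtr.
rewrite addr0 -[1 - (_)%:C%C](rmorphB _ 1) -!rmorphM /= lecR !sub0r !sqrrN => le.
have {le} : ((2 - a) ^+ 2 + b ^+ 2) * (1 - r) ^+ 2
            <= ((1 - a) ^+ 2 + b ^+ 2) * r ^+ 2.
  rewrite -(sqr_sqrtr (ab0 (2 - a))) -(sqr_sqrtr (ab0 (1 - a))) -!exprMn.
  by rewrite ler_sqr // nnegrE mulr_ge0 ?sqrtr_ge0 // subr_ge0 ltW.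
have a2 : a ^+ 2 <= r ^+ 2 by rewrite r2; have := sqr_ge0 b; lra.
have /andP[ar ra] : - r <= a <= r.
  by rewrite -ler_norml -[leRHS]ger0_norm // -ler_sqr ?nnegrE // !real_normK
    ?num_real.
have -> : (2 - a) ^+ 2 + b ^+ 2 = 4 - 4 * a + r ^+ 2 by rewrite r2; ring.
have -> : (1 - a) ^+ 2 + b ^+ 2 = 1 - 2 * a + r ^+ 2 by rewrite r2; ring.
move=> le; rewrite leNgt; apply/negP => gold.
(* The inequality [le] is affine in [a], so it is enough to refute it at the
   endpoints [a = - r] and [a = r]. *)
have lo : ((1 + r) * r) ^+ 2 < ((2 + r) * (1 - r)) ^+ 2.
  by rewrite ltr_sqr ?nnegrE; nra.
(* Here [r < 1] suffices, while [lo] is equivalent to [gold]: the golden ratio comes from the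
   endpoint [a = - r]. *)
have hi : ((1 - r) * r) ^+ 2 < ((2 - r) * (1 - r)) ^+ 2.
  by rewrite ltr_sqr ?nnegrE; nra.
pose f (t : R) : R :=
  (4 - 4 * t + r ^+ 2) * (1 - r) ^+ 2 - (1 - 2 * t + r ^+ 2) * r ^+ 2.
have flo : 0 < f (- r) by rewrite /f; move: lo; lra.
have fhi : 0 < f r by rewrite /f; move: hi; lra.
have fa : f a <= 0 by rewrite /f subr_le0.
have comb : 2 * r * f a = (r - a) * f (- r) + (r + a) * f r by rewrite /f; ring.
have [rp|rn] := ltP 0 r; last first.
  have ar0 : a = - r by lra.
  by move: fa; rewrite ar0 leNgt flo.
have rfa : 2 * r * f a <= 0 by rewrite mulr_ge0_le0 // mulr_ge0.
have : 0 <= (r - a) * f (- r) by rewrite mulr_ge0 ?(ltW flo) //; lra.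
have : 0 <= (r + a) * f r by rewrite mulr_ge0 ?(ltW fhi) //; lra.
(* As [0 < r], the weights [r - a] and [r + a] cannot both vanish; the sign of [a] selects a
   positive one. *)
have [a0|a0] := leP a 0.
  have : 0 < (r - a) * f (- r) by rewrite mulr_gt0 //; lra.
  by lra.
have : 0 < (r + a) * f r by rewrite mulr_gt0 //; lra.
by lra.
Qed.

(** For [r < 1] the bound on the partial sums says that the series vanishes at [w]; otherwise the
    claim is immediate. *)
Lemma unit_interval_series_zero_bound (R : realType) (x : nat -> R) (w : R[i]) (r M : R) :
  `|w| = (r%:C)%C -> x 0%N = 1 -> (forall k, 0 <= x k <= 1) ->
  (forall n, `|\sum_(k < n) (x k)%:C%C * w ^+ k| <= (M * r ^+ n)%:C%C) ->
  1 <= r + r ^+ 2.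
Proof.
move=> wr x0 x01 GM.
have r0 : 0 <= r by have := normr_ge0 w; rewrite wr lecR.
have [r1|r1] := leP 1 r; first by rewrite (le_trans r1) // lerDl exprn_ge0.
apply: (golden_bound_of_norm_sub_le wr) => //.
have normcE_real (u : R[i]) : `|u| = (Normc.normc u)%:C%C by [].
rewrite (normcE_real (2 - w)) (normcE_real (1 - w)) wr -(rmorphB _ 1 r) -!rmorphM /= lecR.
(* In [C], the 1 accounts for [w ^+ n.+1] and [2 * d * M] for the partial sum; both errors vanish as
   [n] grows. *)
set A := Normc.normc _ * _; set d := Normc.normc _; pose C := 1 + 2 * d * M.
have AB n : A <= d * r + C * r ^+ n.+1.
  have wle1 : `|w| <= 1 by rewrite wr lecR ltW.
  have x01C k : 0 <= (x k)%:C%C <= 1 by rewrite !lecR.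
  have := @norm_sub2_partial_sum _ (fun k => (x k)%:C%C) w n
    (congr1 (real_complex R) x0) x01C wle1.
  have d0 : 0 <= 2 * `|1 - w| by rewrite mulr_ge0.
  move=> /le_trans/(_ (lerD (lexx _) (ler_wpM2l d0 (GM n.+1)))).
  rewrite (normcE_real (2 - w)) (normcE_real (1 - w)) wr -/d -(rmorph_nat (real_complex R) 2).
  rewrite -(rmorphB _ 1 r) -!(rmorphXn, rmorphM, rmorphD) /= lecR
    rmorph_nat -/A.
  by rewrite /C; lra.
have lim : (d * r + C * r ^+ n.+1 @[n --> \oo] --> d * r + 0)%classic.
  apply: cvgD; first exact: cvg_cst.
  under eq_cvg do rewrite exprS mulrA.
  by apply: cvg_geometric; rewrite ger0_norm.
have := ler_cvg_to (cvg_cst A) lim.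
rewrite addr0; apply.
by near=> n; exact: AB.
Unshelve. all: by end_near.
Qed.

End ZeroFree.

Theorem corollary2p4 (R : realType) (beta : R) (z : R[i])
    (beta_gt1 : 1 < beta) (beta_nint : beta \isn't a Num.int)
    (beta_yrrap : yrrap beta) (z_conj : galois_conjugate beta z) :
  `|z| <= (((1 + Num.sqrt 5) / 2)%:C)%C.
Proof.
have normcE_real (u : R[i]) : `|u| = (Normc.normc u)%:C%C by [].
have [->|z0] := eqVneq z 0.
  by rewrite normr0 lecR divr_ge0 // addr_ge0 // sqrtr_ge0.
have [M MP] := yrrap_conjugate_bounded beta_yrrap z_conj.
pose w := - z^-1; pose t := Normc.normc z.
have t0 : 0 < t by have : 0 < `|z| by [rewrite normr_gt0]; rewrite normcE_real ltcR.
have wt : `|w| = (t^-1)%:C%C by rewrite normrN normfV normcE_real fmorphV.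
(* The factor of the sum in [orbit_poly_conjugate], nonzero since [z] differs from [beta]. *)
pose c := (beta%:C%C - z) * w.
have c0 : 0 < Normc.normc c.
  suff : 0 < `|c| by rewrite normcE_real ltcR.
  rewrite normr_gt0 mulf_neq0 ?oppr_eq0 ?invr_eq0 // subr_eq0.
  by apply/eqP => bz; case: z_conj => + _; apply.
have le1 : 1 <= t^-1 + t^-1 ^+ 2.
  apply: (@unit_interval_series_zero_bound _ (fun n => iter n (neg_beta_map beta) 1) w t^-1
    (M / Normc.normc c)) => // [|n]; first exact: neg_beta_orbit_itv.
  rewrite mulrAC rmorphM fmorphV /= ler_pdivlMr ?ltcR // -normcE_real mulrC -normrM.
  rewrite -orbit_poly_conjugate // normrM normrX wt rmorphM rmorphXn /=.
  by rewrite ler_wpM2r // exprn_ge0 // lecR invr_ge0 ltW.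
rewrite normcE_real lecR -/t.
have t1 : t ^+ 2 <= t + 1.
  have : t ^+ 2 * 1 <= t ^+ 2 * (t^-1 + t^-1 ^+ 2)
    by rewrite ler_wpM2l ?sqr_ge0.
  by rewrite mulr1 (_ : _ * _ = t + 1) //; field; rewrite gt_eqF.
have s0 := sqrtr_ge0 (5 : R).
have s5 : Num.sqrt 5 ^+ 2 = 5 :> R by rewrite sqr_sqrtr.
(* By [t1], [t] is at most the larger root of [t ^+ 2 - t - 1]. *)
by nra.
Qed.
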